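(* Let $\mathcal{C}_1$ and $\mathcal{C}_2$ be Cantor sets with topological group structures. Then there is a Borel isomorphism between $\mathcal{C}_1$ and $\mathcal{C}_2$.
   Context: A Cantor set is a nonempty compact Hausdorff zero-dimensional space that has a countable base for its topology and in which every point is a limit point. A topological group structure on such a space is a group structure for which multiplication and inversion are continuous. A Borel isomorphism is a bijection that is Borel measurable and whose inverse is Borel measurable. *)

(* Defs.v *)
From HB Require Import structures.
From mathcomp Require Import all_boot.
From mathcomp Require Import all_classical.
From mathcomp Require Import topology measure.

Set Implicit Arguments.
Unset Strict Implicit.
Unset Printing Implicit Defensive.

Local Open Scope classical_set_scope.

(* [zero_dimensional] of the library only asks that clopen sets separate
   points; zero-dimensionality is taken here in its usual sense, namely that
   the clopen sets form a base. *)
Definition cantor_set (T : topologicalType) : Prop :=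
  [/\ [set: T] !=set0 /\ compact [set: T],
      hausdorff_space T,
      basis (@clopen T),
      @second_countable T &
      forall x : T, limit_point [set: T] x].

(* Group structures are not assumed to be commutative, so the library's
   [topologicalZmodType] is too restrictive. *)
HB.mixin Record isTopologicalGroup G & Topological G & Group G := {
  mulg_continuous : continuous (fun x : G * G => (x.1 * x.2)%g) ;
  invg_continuous : continuous (fun x : G => (x^-1)%g)
}.

#[short(type="topologicalGroupType")]
HB.structure Definition TopologicalGroup :=
  {G of Topological G & Group G & isTopologicalGroup G}.

Definition borel (T : topologicalType) : set (set T) := <<s @open T >>.
Arguments borel : clear implicits.

(* This is [measurable_fun setT f] for the Borel sigma-algebras; the library's
   measurable types carry a distinguished point, topological spaces do not. *)
Definition borel_measurable (T U : topologicalType) (f : T -> U) : Prop :=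
  forall B : set U, borel U B -> borel T (f @^-1` B).

Definition borel_isomorphism (T U : topologicalType) (f : T -> U) : Prop :=
  exists g : U -> T,
    [/\ cancel f g, cancel g f, borel_measurable f & borel_measurable g].

(* Main.v *)
Require Import Defs.
From mathcomp Require Import all_boot.
From mathcomp Require Import all_classical.
From mathcomp Require Import topology measure.
From HB Require Import structures.
From mathcomp Require Import cantor.

(** By Brouwer's theorem a Cantor set is homeomorphic to [bool^nat], so two
    Cantor sets are homeomorphic, and a homeomorphism is a Borel isomorphism.
    For Brouwer's theorem, enumerate the clopen sets as [U_ n] and build a
    binary tree of nonempty clopen sets, cutting each node of level [n] along
    [U_ n] if this leaves both halves nonempty, and along some other clopen set
    otherwise; every branch then shrinks to a single point. *)

Set Implicit Arguments.
Unset Strict Implicit.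
Unset Printing Implicit Defensive.

Local Open Scope classical_set_scope.

(** The sets with Borel preimage form a sigma-algebra containing the open sets. *)
Lemma continuous_borel_measurable (T U : topologicalType) (f : T -> U) :
  continuous f -> borel_measurable f.
Proof.
move=> ctsf; apply: smallest_sub => [|A oA].
  split=> [|A mA|A mA]; rewrite /= ?preimage_set0.
  - exact: sigma_algebra0.
  - by rewrite setTD preimage_setC -setTD; exact: sigma_algebraCD.
  - by rewrite preimage_bigcup; exact: sigma_algebra_bigcup.
by apply: sub_sigma_algebra; move/continuousP: ctsf; apply.
Qed.

(** Preimages under [g] are images under [f], and [f] maps closed sets to compact, hence closed,
    sets. *)
Lemma compact_hausdorff_cancel_continuous (X Y : topologicalType)
    (f : X -> Y) (g : Y -> X) :
  compact [set: X] -> hausdorff_space Y -> continuous f ->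
  cancel f g -> cancel g f -> continuous g.
Proof.
move=> cptX hsdY ctsf fK gK; apply/continuous_closedP => A clA.
have -> : g @^-1` A = f @` A.
  by rewrite eqEsubset; split=> [y Ay|_ [x Ax <-]]; [exists (g y)|rewrite /= fK].
apply: (compact_closed hsdY); apply: continuous_compact.
  exact: continuous_subspaceT.
exact: subclosed_compact cptX _.
Qed.

Lemma basis_clopen_zero_dimensional (T : topologicalType) :
  hausdorff_space T -> basis (@clopen T) -> zero_dimensional T.
Proof.
move=> /hausdorff_accessible acc [_ bT] x y /acc [U [oU /set_mem Ux /set_mem Uy]].
have [V [cV Vx] VU] := bT x U (open_nbhs_nbhs (conj oU Ux)).
exists V; split=> // Vy; apply: Uy; exact: VU.
Qed.

(** Supplies the fallback cut: a limit point of the space shares [U] with a second point, and a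
    clopen set separates the two. *)
Lemma clopen_split (T : topologicalType) (U : set T) :
  zero_dimensional T -> (forall x : T, limit_point [set: T] x) ->
  open U -> U !=set0 ->
  exists V, [/\ clopen V, U `&` V !=set0 & U `&` ~` V !=set0].
Proof.
move=> zdT limT oU [x Ux].
have [y [yx _ Uy]] := limT x U (open_nbhs_nbhs (conj oU Ux)).
have [V [cV Vy Vx]] := zdT y x yx.
by exists V; split=> //; [exists y|exists x].
Qed.

Lemma cantor_set_cantor_space (T : ptopologicalType) :
  cantor_set T ->
  exists2 f : cantor_space -> T, continuous f & bijective f.
Proof.
move=> [[_ cptT] hsdT bT scT limT].
have zdT := basis_clopen_zero_dimensional hsdT bT.
(* A clopen set is compact, so it is a finite union of basic open sets; hence there are only
   countably many. *)
have [U_ U_surj] : exists U_ : nat -> set T, set_surj setT (@clopen T) U_.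
  exact/pcard_surjP/clopen_countable.
(* The second clause allows any [U], since points must later be separated inside arbitrary sets, not
   only nonempty clopen ones. Where neither clause applies, [set0] is a dummy value. *)
have cut_ex n (U : set T) : exists V : set T,
    (clopen U /\ U !=set0 ->
      [/\ clopen V, U `&` V !=set0 & U `&` ~` V !=set0]) /\
    ([/\ clopen (U_ n), U `&` U_ n !=set0 & U `&` ~` U_ n !=set0] ->
      V = U_ n).
  have [UnP|UnP] := pselect
    [/\ clopen (U_ n), U `&` U_ n !=set0 & U `&` ~` U_ n !=set0].
    by exists (U_ n).
  have [[[oU cU] U0]|nU] := pselect (clopen U /\ U !=set0); last by exists set0.
  by have [V VP] := clopen_split zdT limT oU U0; exists V.
pose cut n U := projT1 (cid (cut_ex n U)).
have cutP n U : clopen U /\ U !=set0 ->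
    [/\ clopen (cut n U), U `&` cut n U !=set0 & U `&` ~` cut n U !=set0].
  by have [] := projT2 (cid (cut_ex n U)).
have cutE n U : [/\ clopen (U_ n), U `&` U_ n !=set0 & U `&` ~` U_ n !=set0] ->
    cut n U = U_ n.
  by have [] := projT2 (cid (cut_ex n U)).
pose half n (U : set T) (b : bool) := U `&` (if b then cut n U else ~` cut n U).
have [//|//|||||||f [ctsf surjf injf]] :=
    @tree_map_props (fun=> bool) T half (fun U => clopen U /\ U !=set0).
- move=> n U; rewrite eqEsubset; split=> [t Ut|t [b _ []]//].
  by have [cutt|cutt] := pselect (cut n U t); [exists true|exists false].
- move=> n U b UP; have [cV ? ?] := cutP n U UP; case: UP => cU _.
  by rewrite /half; case: b; split=> //; apply: clopenI => //; exact: clopenC.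
- by move=> U [].
- by split; [exact: clopenT|exists point].
- by move=> U [[]].
(* If [x] and [y] lay in the same half of [U] at level [n], then [U] would meet both [A] and its
   complement, so the cut would be along [A], which separates them. *)
- move=> x y /zdT [A [cA Ax Ay]]; have [n _ UnA] := U_surj A cA.
  exists n => U b [Ux cutx] [Uy cuty].
  have cutA : cut n U = A.
    by rewrite -UnA; apply: cutE; rewrite UnA; split=> //; [exists x|exists y].
  by case: b cutx cuty; rewrite cutA.
(* Injectivity reduces to the disjointness of the two halves of each [U]. *)
exists f => //; rewrite -setTT_bijective; split=> //; apply: injf => n U.
by move=> [] [] _ _ [z [[_ zb] [_ zc]]].
Qed.

Theorem theorem7 (C1 C2 : topologicalGroupType)
    (cantorC1 : cantor_set C1) (cantorC2 : cantor_set C2) :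
  exists f : C1 -> C2, borel_isomorphism f.
Proof.
have brouwer (C : topologicalGroupType) : cantor_set C ->
    exists2 f : cantor_space -> C, continuous f &
      exists2 g, continuous g & cancel f g /\ cancel g f.
  move=> cantorC.
  (* The group identity serves as the distinguished point. *)
  pose X : ptopologicalType := HB.pack C (isPointed.Build C 1%g).
  have [f ctsf [g fK gK]] := @cantor_set_cantor_space X cantorC.
  exists f => //; exists g => //.
  apply: compact_hausdorff_cancel_continuous fK gK => //.
    exact: cantor_space_compact.
  by case: cantorC.
have [f1 ctsf1 [g1 ctsg1 [fK1 gK1]]] := brouwer C1 cantorC1.
have [f2 ctsf2 [g2 ctsg2 [fK2 gK2]]] := brouwer C2 cantorC2.
exists (f2 \o g1), (f1 \o g2); split.
- exact: can_comp fK2 gK1.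
- exact: can_comp fK1 gK2.
- apply: continuous_borel_measurable => x.
  by apply: continuous_comp; [exact: ctsg1|exact: ctsf2].
- apply: continuous_borel_measurable => x.
  by apply: continuous_comp; [exact: ctsg2|exact: ctsf1].
Qed.
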